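(* Let $A \in \mathbb{R}^{m \times n}$ be an entrywise nonnegative matrix and let $W\in\mathbb{R}^{m\times n}$ be an optimal solution of the program defining $\nu_+(A)$, i.e. $\begin{bmatrix} I & -W\\ -W^{T} & I \end{bmatrix}$ is copositive and $\langle A,W\rangle=\nu_+(A)$. Let $\epsilon$ be a positive constant with $\epsilon \leq \nu_+(A) / \|W\|_F$. Then \[ \operatorname{rank}_+^{\epsilon}(A) \geq \left(\frac{\nu_+(A) - \epsilon \|W\|_F}{\|A\|_F+\epsilon}\right)^2. \]
   Context: The nonnegative rank $\operatorname{rank}_+(A)$ of an entrywise nonnegative matrix $A\in\mathbb{R}^{m\times n}$ is the smallest integer $r$ such that $A=UV$ with $U\in\mathbb{R}^{m\times r}$ and $V\in\mathbb{R}^{r\times n}$ both entrywise nonnegative (the zero matrix has nonnegative rank $0$). The approximate nonnegative rank is \[ \operatorname{rank}_+^{\epsilon}(A) = \min \{ \operatorname{rank}_+(\tilde{A}) : \tilde{A} \in \mathbb{R}^{m \times n} \text{ entrywise nonnegative and } \|A - \tilde{A}\|_F \leq \epsilon \}, \] where $\|\cdot\|_F$ is the Frobenius norm. A symmetric matrix $M \in \mathbb{R}^{N\times N}$ is copositive if $x^{T} M x \geq 0$ for all entrywise nonnegative $x\in \mathbb{R}^{N}$. With $\langle X,Y\rangle = \operatorname{trace}(X^{T}Y)$, \[ \nu_+(A) = \max_{W \in \mathbb{R}^{m \times n}} \left\{ \langle A, W \rangle \; : \; \begin{bmatrix} I & -W\\ -W^{T} & I \end{bmatrix} \text{ is copositive}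 \right\}\] (the optimal value of this program). *)

(* Defs.v *)
From mathcomp Require Import all_boot all_order all_algebra.
From mathcomp Require Import boolp classical_sets reals.

Set Implicit Arguments.
Unset Strict Implicit.
Unset Printing Implicit Defensive.

Import Order.TTheory GRing.Theory Num.Theory.
Local Open Scope classical_set_scope.
Local Open Scope ring_scope.

Definition is_min_nat (P : set nat) (r : nat) : Prop :=
  P r /\ (forall s, P s -> (r <= s)%N).

(* The default [0] is returned only when [P] is empty; see [min_natP]. *)
Definition min_nat (P : set nat) : nat := xget 0%N [set r | is_min_nat P r].

Lemma min_natP (P : set nat) : P !=set0 -> is_min_nat P (min_nat P).
Proof.
case=> n Pn; rewrite /min_nat.
apply: (@xgetPex nat 0%N [set r | is_min_nat P r]).
have exP : exists k, `[< P k >] by exists n; apply/asboolP.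
exists (ex_minn exP); case: ex_minnP => k /asboolP Pk k_min.
by split=> // s Ps; apply: k_min; apply/asboolP.
Qed.

Definition nonneg_mx (R : realType) (m n : nat) (A : 'M[R]_(m, n)) : Prop :=
  forall i j, 0 <= A i j.

Definition nonneg_factorization (R : realType) (m n : nat) (A : 'M[R]_(m, n))
    (r : nat) : Prop :=
  exists (U : 'M[R]_(m, r)) (V : 'M[R]_(r, n)),
    [/\ nonneg_mx U, nonneg_mx V & A = U *m V].

(* Meaningful for entrywise nonnegative [A], see [nonneg_rank_min]. *)
Definition nonneg_rank (R : realType) (m n : nat) (A : 'M[R]_(m, n)) : nat :=
  min_nat [set r | nonneg_factorization A r].

Lemma nonneg_rank_min (R : realType) (m n : nat) (A : 'M[R]_(m, n)) :
  nonneg_mx A -> is_min_nat [set r | nonneg_factorization A r] (nonneg_rank A).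
Proof.
move=> A_ge0; apply: min_natP; exists n; exists A, 1%:M; split=> //.
- by move=> i j; rewrite mxE ler0n.
- by rewrite mulmx1.
Qed.

Definition frob_dot (R : realType) (m n : nat) (X Y : 'M[R]_(m, n)) : R :=
  \tr (X^T *m Y).

Definition frob_norm (R : realType) (m n : nat) (X : 'M[R]_(m, n)) : R :=
  Num.sqrt (\sum_i \sum_j X i j ^+ 2).

Definition approx_nonneg_rank (R : realType) (m n : nat) (eps : R)
    (A : 'M[R]_(m, n)) : nat :=
  min_nat [set r | exists At : 'M[R]_(m, n),
    [/\ nonneg_mx At, frob_norm (A - At) <= eps & nonneg_rank At = r]].

Lemma approx_nonneg_rank_min (R : realType) (m n : nat) (eps : R)
    (A : 'M[R]_(m, n)) :
  0 <= eps -> nonneg_mx A ->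
  is_min_nat [set r | exists At : 'M[R]_(m, n),
    [/\ nonneg_mx At, frob_norm (A - At) <= eps & nonneg_rank At = r]]
    (approx_nonneg_rank eps A).
Proof.
move=> eps_ge0 A_ge0; apply: min_natP; exists (nonneg_rank A); exists A.
split=> //; rewrite subrr /frob_norm big1 ?sqrtr0 // => i _.
by rewrite big1 // => j _; rewrite mxE expr0n.
Qed.

Definition copositive (R : realType) (N : nat) (M : 'M[R]_N) : Prop :=
  M^T = M /\
  (forall x : 'cV[R]_N, nonneg_mx x -> 0 <= (x^T *m M *m x) ord0 ord0).

Definition nu_plus_feasible (R : realType) (m n : nat) (W : 'M[R]_(m, n)) :
    Prop :=
  copositive (block_mx 1%:M (- W) (- W^T) 1%:M).

(* The supremum of the objective values; for entrywise nonnegative [A] it is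
   that of a nonempty bounded set, see [nu_plus_has_sup]. *)
Definition nu_plus (R : realType) (m n : nat) (A : 'M[R]_(m, n)) : R :=
  sup [set frob_dot A W | W in [set W : 'M[R]_(m, n) | nu_plus_feasible W]].

Definition nu_plus_optimal (R : realType) (m n : nat) (A W : 'M[R]_(m, n)) :
    Prop :=
  nu_plus_feasible W /\ frob_dot A W = nu_plus A.

Lemma nu_plus_feasible_le1 (R : realType) (m n : nat) (W : 'M[R]_(m, n)) i j :
  nu_plus_feasible W -> W i j <= 1.
Proof.
case=> _ /(_ (col_mx (delta_mx i 0) (delta_mx j 0))) copW.
have /copW : nonneg_mx (col_mx (delta_mx i 0) (delta_mx j 0) : 'cV[R]_(m + n)).
  by move=> k l; rewrite mxE; case: split => k'; rewrite mxE ler0n.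
rewrite tr_col_mx !trmx_delta mul_row_block mul_row_col !mulmx1.
rewrite !mulmxDl !mulmxN !mulNmx !mul_delta_mx -!rowE -!colE !mxE !eqxx /=.
by rewrite [- _ + 1]addrC -mulr2n pmulrn_lge0 // subr_ge0.
Qed.

Lemma nu_plus_has_sup (R : realType) (m n : nat) (A : 'M[R]_(m, n)) :
  nonneg_mx A ->
  has_sup [set frob_dot A W | W in [set W : 'M[R]_(m, n) | nu_plus_feasible W]].
Proof.
move=> A_ge0; split.
  exists (frob_dot A 0); exists 0 => //=; split.
    by rewrite tr_block_mx !linearN /= !trmx0 !trmx1.
  move=> x x_ge0; rewrite trmx0 !oppr0 -scalar_mx_block mulmx1 mxE.
  by apply: sumr_ge0 => k _; rewrite mxE mulr_ge0.
exists (\sum_j \sum_i A i j) => _ [W /= Wfeas <-].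
apply: ler_sum => j _; rewrite mxE; apply: ler_sum => i _; rewrite mxE.
by rewrite ler_piMr // nu_plus_feasible_le1.
Qed.

(* Main.v *)
(* For W feasible and u, v nonnegative, copositivity at (|v| u, |u| v) gives
   u^T W v <= |u| |v|.  Writing a nonnegative approximation of A as a sum of r
   nonnegative rank-one terms u_k v_k^T, Cauchy-Schwarz bounds its pairing with
   W by sqrt r times the square root of the sum of the |u_k v_k^T|^2; as all the
   terms are nonnegative, this sum is at most the squared norm of the
   approximation. *)
Require Import Defs.
From mathcomp Require Import all_boot all_order all_algebra.
From mathcomp Require Import boolp classical_sets reals.
From mathcomp Require Import ring lra.

Set Implicit Arguments.
Unset Strict Implicit.
Unset Printing Implicit Defensive.

Import Order.TTheory GRing.Theory Num.Theory.
Local Open Scope ring_scope.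

(** Lagrange's identity: the double sum of the squares $(a_i b_j - a_j b_i)^2$ is twice the right
    side minus the left side. *)
Lemma sum_Cauchy_Schwarz (R : realDomainType) (I : finType) (a b : I -> R) :
  (\sum_i a i * b i) ^+ 2 <= (\sum_i a i ^+ 2) * (\sum_i b i ^+ 2).
Proof.
have H : 0 <= \sum_i \sum_j (a i * b j - a j * b i) ^+ 2.
  by do 2![apply: sumr_ge0 => ? _]; apply: sqr_ge0.
suff E : \sum_i \sum_j (a i * b j - a j * b i) ^+ 2 =
    ((\sum_i a i ^+ 2) * (\sum_i b i ^+ 2) - (\sum_i a i * b i) ^+ 2) *+ 2.
  by rewrite -subr_ge0 -(pmulrn_lge0 _ (isT : (0 < 2)%N)) -E.
transitivity (\sum_i \sum_j (a i ^+ 2 * b j ^+ 2 + b i ^+ 2 * a j ^+ 2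
    - (a i * b i) * (a j * b j) *+ 2)).
  by do 2![apply: eq_bigr => ? _]; ring.
under eq_bigr do rewrite sumrB big_split /= sumrMnl -!mulr_sumr.
by rewrite sumrB big_split /= sumrMnl -!mulr_suml; ring.
Qed.

Lemma sum_sqr_le_sqr_sum (R : numDomainType) (I : finType) (a : I -> R) :
  (forall i, 0 <= a i) -> \sum_i a i ^+ 2 <= (\sum_i a i) ^+ 2.
Proof.
move=> a_ge0; rewrite expr2 mulr_suml; apply: ler_sum => i _.
rewrite expr2 ler_wpM2l // (bigD1 i) //= lerDl.
by apply: sumr_ge0.
Qed.

Lemma frob_dotE (R : realType) (m n : nat) (X Y : 'M[R]_(m, n)) :
  frob_dot X Y = \sum_i \sum_j X i j * Y i j.
Proof.
rewrite /frob_dot /mxtrace exchange_big; apply: eq_bigr => j _.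
by rewrite mxE; apply: eq_bigr => i _; rewrite mxE.
Qed.

Lemma frob_norm_ge0 (R : realType) (m n : nat) (X : 'M[R]_(m, n)) :
  0 <= frob_norm X.
Proof. exact: sqrtr_ge0. Qed.

Lemma frob_norm_sqr (R : realType) (m n : nat) (X : 'M[R]_(m, n)) :
  frob_norm X ^+ 2 = \sum_i \sum_j X i j ^+ 2.
Proof.
by rewrite sqr_sqrtr //; do 2![apply: sumr_ge0 => ? _]; apply: sqr_ge0.
Qed.

Lemma frob_norm_sqr_dot (R : realType) (m n : nat) (X : 'M[R]_(m, n)) :
  frob_norm X ^+ 2 = frob_dot X X.
Proof. by rewrite frob_norm_sqr frob_dotE. Qed.

Lemma frob_norm_eq0 (R : realType) (m n : nat) (X : 'M[R]_(m, n)) :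
  frob_norm X = 0 -> X = 0.
Proof.
move=> X0; apply/matrixP => i j; rewrite mxE; apply/eqP.
have /eqP := frob_norm_sqr X; rewrite X0 expr0n eq_sym pair_big /=.
rewrite psumr_eq0 => [|p _]; last exact: sqr_ge0.
by move=> /allP /(_ (i, j)); rewrite mem_index_enum sqrf_eq0; apply.
Qed.

Lemma frob_Cauchy_Schwarz (R : realType) (m n : nat) (X Y : 'M[R]_(m, n)) :
  frob_dot X Y <= frob_norm X * frob_norm Y.
Proof.
apply: le_trans (ler_norm _) _; rewrite -ler_sqr ?nnegrE ?mulr_ge0 //;
  try exact: frob_norm_ge0.
rewrite real_normK ?num_real // exprMn !frob_norm_sqr frob_dotE !pair_big.
exact: sum_Cauchy_Schwarz.
Qed.

Lemma frob_dotDl (R : realType) (m n : nat) (X Y Z : 'M[R]_(m, n)) :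
  frob_dot (X + Y) Z = frob_dot X Z + frob_dot Y Z.
Proof. by rewrite /frob_dot !linearD /= mulmxDl linearD. Qed.

Lemma frob_dotC (R : realType) (m n : nat) (X Y : 'M[R]_(m, n)) :
  frob_dot X Y = frob_dot Y X.
Proof. by rewrite /frob_dot -mxtrace_tr trmx_mul trmxK. Qed.

Lemma frob_normD (R : realType) (m n : nat) (X Y : 'M[R]_(m, n)) :
  frob_norm (X + Y) <= frob_norm X + frob_norm Y.
Proof.
rewrite -ler_sqr ?nnegrE ?addr_ge0 ?frob_norm_ge0 //.
rewrite sqrrD !frob_norm_sqr_dot frob_dotDl ![frob_dot _ (X + Y)]frob_dotC.
rewrite !frob_dotDl (frob_dotC Y X).
by have := frob_Cauchy_Schwarz X Y; lra.
Qed.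

Lemma frob_normB (R : realType) (m n : nat) (X Y : 'M[R]_(m, n)) :
  frob_norm (X - Y) = frob_norm (Y - X).
Proof.
congr Num.sqrt; do 2![apply: eq_bigr => ? _].
by rewrite !mxE -sqrrN opprB.
Qed.

Lemma frob_normZ (R : realType) (m n : nat) (a : R) (X : 'M[R]_(m, n)) :
  0 <= a -> frob_norm (a *: X) = a * frob_norm X.
Proof.
move=> a_ge0; apply/eqP.
rewrite -(@eqrXn2 _ 2) ?mulr_ge0 ?frob_norm_ge0 // exprMn !frob_norm_sqr.
rewrite mulr_sumr; apply/eqP; apply: eq_bigr => i _; rewrite mulr_sumr.
by apply: eq_bigr => j _; rewrite mxE exprMn.
Qed.

Lemma mulmx_tr_cV (R : realType) (n : nat) (x : 'cV[R]_n) :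
  x^T *m x = (frob_norm x ^+ 2)%:M.
Proof. by rewrite frob_norm_sqr_dot /frob_dot trace_mx11 -mx11_scalar. Qed.

(** At the stacked vector $(x, y)$ the copositive form equals $|x|^2 + |y|^2 - 2 x^T W y$. *)
Lemma nu_plus_feasible_le (R : realType) (m n : nat) (W : 'M[R]_(m, n))
    (x : 'cV[R]_m) (y : 'cV[R]_n) :
  nu_plus_feasible W -> nonneg_mx x -> nonneg_mx y ->
  (x^T *m W *m y) 0 0 <= (frob_norm x ^+ 2 + frob_norm y ^+ 2) / 2.
Proof.
case=> _ /(_ (col_mx x y)) copW x_ge0 y_ge0.
have /copW : nonneg_mx (col_mx x y).
  by move=> k l; rewrite mxE; case: split.
rewrite tr_col_mx mul_row_block mul_row_col !mulmx1 !mulmxDl.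
(* The two cross terms agree, since a 1 by 1 matrix is its own transpose. *)
have -> : y^T *m - W^T *m x = - (x^T *m W *m y).
  rewrite mulmxN mulNmx [x^T *m W *m y]mx11_scalar -tr_scalar_mx.
  by rewrite -mx11_scalar !trmx_mul trmxK mulmxA.
rewrite mulmxN mulNmx !mulmx_tr_cV !mxE eqxx !mulr1n.
by lra.
Qed.

Lemma nu_plus_feasible_mul_le (R : realType) (m n : nat) (W : 'M[R]_(m, n))
    (x : 'cV[R]_m) (y : 'cV[R]_n) :
  nu_plus_feasible W -> nonneg_mx x -> nonneg_mx y ->
  (x^T *m W *m y) 0 0 <= frob_norm x * frob_norm y.
Proof.
move=> Wfeas x_ge0 y_ge0.
(* Zero vectors are treated apart: the main case cancels a factor $|x| |y|$. *)
have [/frob_norm_eq0->|x_neq0] := eqVneq (frob_norm x) 0.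
  by rewrite trmx0 !mul0mx mxE mulr_ge0 ?frob_norm_ge0.
have [/frob_norm_eq0->|y_neq0] := eqVneq (frob_norm y) 0.
  by rewrite mulmx0 mxE mulr_ge0 ?frob_norm_ge0.
have p_gt0 : 0 < frob_norm x * frob_norm y.
  by rewrite mulr_gt0 ?lt0r ?frob_norm_ge0 ?x_neq0 ?y_neq0.
(* Both rescaled vectors have norm $|x| |y|$, so the mean of their squared norms is $(|x| |y|)^2$,
   while the left side becomes $|x| |y|$ times $x^T W y$. *)
have := @nu_plus_feasible_le _ _ _ W (frob_norm y *: x) (frob_norm x *: y) Wfeas.
rewrite !frob_normZ ?frob_norm_ge0 // !linearZ /= -!scalemxAl.
rewrite scalerA mxE => le_xy.
rewrite -(ler_pM2l p_gt0); apply: le_trans (le_xy _ _) _.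
- by move=> i j; rewrite mxE mulr_ge0 ?frob_norm_ge0.
- by move=> i j; rewrite mxE mulr_ge0 ?frob_norm_ge0.
by rewrite le_eqVlt; apply/orP; left; apply/eqP; field.
Qed.

(** By cyclicity the trace of $V^T U^T W$ is that of $U^T W V^T$, whose diagonal entries are the
    summands. *)
Lemma frob_dot_mulmx (R : realType) (m n r : nat) (U : 'M[R]_(m, r))
    (V : 'M[R]_(r, n)) (W : 'M[R]_(m, n)) :
  frob_dot (U *m V) W = \sum_k ((col k U)^T *m W *m (row k V)^T) 0 0.
Proof.
rewrite /frob_dot trmx_mul -mulmxA mxtrace_mulC; apply: eq_bigr => k _.
rewrite tr_col tr_row -row_mul !mxE; apply: eq_bigr => j _.
by congr (_ * _); rewrite [RHS]mxE.
Qed.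

(** Each product of norms is the Frobenius norm of a rank-one term of [U *m V]. In every entry the
    terms add up without cancellation, so the sum of their squares is at most the square of their
    sum. *)
Lemma frob_norm_mulmx_ge (R : realType) (m n r : nat) (U : 'M[R]_(m, r))
    (V : 'M[R]_(r, n)) :
  nonneg_mx U -> nonneg_mx V ->
  \sum_k (frob_norm (col k U) * frob_norm (row k V)^T) ^+ 2
    <= frob_norm (U *m V) ^+ 2.
Proof.
move=> U_ge0 V_ge0.
have -> : \sum_k (frob_norm (col k U) * frob_norm (row k V)^T) ^+ 2 =
    \sum_i \sum_j \sum_k (U i k * V k j) ^+ 2.
  under [RHS]eq_bigr do rewrite exchange_big.
  rewrite [RHS]exchange_big; apply: eq_bigr => k _.
  rewrite exprMn !frob_norm_sqr mulr_suml; apply: eq_bigr => i _.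
  rewrite big_ord1 mulr_sumr; apply: eq_bigr => j _.
  by rewrite big_ord1 !mxE exprMn.
rewrite frob_norm_sqr; do 2![apply: ler_sum => ? _].
by rewrite mxE; apply: sum_sqr_le_sqr_sum => k; apply: mulr_ge0.
Qed.

Lemma frob_dot_factorization_le (R : realType) (m n r : nat)
    (B W : 'M[R]_(m, n)) :
  nu_plus_feasible W -> nonneg_factorization B r ->
  frob_dot B W <= Num.sqrt r%:R * frob_norm B.
Proof.
move=> Wfeas [U] [V] [U_ge0 V_ge0 ->].
pose c k := frob_norm (col k U) * frob_norm (row k V)^T.
(* The factor 1 prepares Cauchy-Schwarz against the all-ones vector of length [r], the source of
   $\sqrt r$. *)
apply: (@le_trans _ _ (\sum_k 1 * c k)).
  rewrite frob_dot_mulmx; apply: ler_sum => k _; rewrite mul1r.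
  by apply: nu_plus_feasible_mul_le => // i j; rewrite !mxE.
apply: le_trans (ler_norm _) _.
rewrite -ler_sqr ?nnegrE ?mulr_ge0 ?sqrtr_ge0 ?frob_norm_ge0 //.
rewrite real_normK ?num_real // exprMn sqr_sqrtr ?ler0n //.
apply: le_trans (sum_Cauchy_Schwarz _ _) _.
under eq_bigr do rewrite expr1n.
by rewrite sumr_const card_ord ler_wpM2l ?ler0n ?frob_norm_mulmx_ge.
Qed.

Theorem theorem3 (R : realType) (m n : nat) (A W : 'M[R]_(m, n)) (eps : R)
    (A_ge0 : nonneg_mx A) (W_opt : nu_plus_optimal A W)
    (eps_gt0 : 0 < eps) (eps_le : eps <= nu_plus A / frob_norm W) :
  ((nu_plus A - eps * frob_norm W) / (frob_norm A + eps)) ^+ 2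
    <= (approx_nonneg_rank eps A)%:R.
Proof.
case: W_opt => Wfeas AW.
(* [B] is an approximation of [A] attaining the approximate rank. *)
have [[B [B_ge0 AB_le <-]] _] := approx_nonneg_rank_min (ltW eps_gt0) A_ge0.
have [/(frob_dot_factorization_le Wfeas) BW_le _] := nonneg_rank_min B_ge0.
(* Division by zero yields 0, so a vanishing norm of [W] would turn [eps_le] into [eps <= 0]. *)
have W_gt0 : 0 < frob_norm W.
  rewrite lt0r frob_norm_ge0 andbT; apply: contraTneq eps_le => ->.
  by rewrite invr0 mulr0 -ltNge.
have den_gt0 : 0 < frob_norm A + eps by rewrite ltr_wpDl ?frob_norm_ge0.
(* Removing the squares requires a nonnegative numerator, which is what [eps_le] provides. *)
rewrite -[leRHS]sqr_sqrtr ?ler0n // ler_sqr ?nnegrE ?sqrtr_ge0 //; last first.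
  by rewrite divr_ge0 ?(ltW den_gt0) // subr_ge0 -ler_pdivlMr.
rewrite ler_pdivrMr // -AW.
have B_le : frob_norm B <= frob_norm A + eps.
  rewrite -(addrNK A B) addrC; apply: le_trans (frob_normD _ _) _.
  by rewrite lerD2l frob_normB.
apply: le_trans (le_trans BW_le (ler_wpM2l (sqrtr_ge0 _) B_le)).
(* Split $\langle A, W\rangle$ as $\langle A - B, W\rangle + \langle B, W\rangle$; Cauchy-Schwarz
   bounds the first term by $\epsilon \|W\|_F$. *)
rewrite lerBlDr -{1}(addrNK B A) addrC frob_dotDl addrC [leRHS]addrC lerD2r.
apply: le_trans (frob_Cauchy_Schwarz _ _) _.
by rewrite ler_wpM2r ?frob_norm_ge0.
Qed.
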